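(* Let $N=\{1,\dots,n\}$, $M=\{1,\dots,m\}$, $\mathcal{X}=\{0,1\}^m$ and $\mathcal{F}=\{a\in\mathcal{X}^n:\sum_{i\in N}a_{ij}\le 1\ \forall j\in M\}$. For each $i\in N$ let $\mathcal{N}^i_{(W^i,b^i)}:\mathcal{X}\to\mathbb{R}_+$ be an MVNN with cutoff $1$, weights $W^i=(W^{i,k})_{k=1}^{K_i}$, biases $b^i=(b^{i,k})_{k=1}^{K_i-1}$ and layer dimensions $d^{i,0}=m,d^{i,1},\dots,d^{i,K_i}=1$. Then the winner determination problem $$\max_{a\in\mathcal{F}}\ \sum_{i\in N}\mathcal{N}^i_{(W^i,b^i)}(a_i)$$ can be equivalently formulated as the following mixed-integer linear program, provided the constants $L_1^{i,k},L_2^{i,k},L_3^{i,k},L_4^{i,k}\in\mathbb{R}_+$ are large enough: $$\max_{a\in\mathcal{F},\,z^{i,k},\,\mu^{i,k},\,\eta^{i,k},\,y^{i,k}}\ \sum_{i\in N}W^{i,K_i}z^{i,K_i-1}$$ subject to, for all $i\in N$, $z^{i,0}=a_i$, and for all $i\in N$ and $k\in\{1,\dots,K_i-1\}$ (all inequalities componentwise, constants acting on each component): $$W^{i,k}z^{i,k-1}+b^{i,k}\le \eta^{i,k},$$ $$\eta^{i,k}\le W^{i,k}z^{i,k-1}+b^{i,k}+y^{i,k}\cdot L_1^{i,k},$$ $$0\le\eta^{i,k}\le(1-y^{i,k})\cdot L_2^{i,k},$$ $$\eta^{i,k}-\mu^{i,k}\cdot L_3^{i,k}\le z^{i,k}\le\eta^{i,k},$$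 $$1-(1-\mu^{i,k})\cdot L_4^{i,k}\le z^{i,k}\le 1,$$ $$y^{i,k}\in\{0,1\}^{d^{i,k}},\qquad \mu^{i,k}\in\{0,1\}^{d^{i,k}},$$ with $z^{i,k},\eta^{i,k}\in\mathbb{R}^{d^{i,k}}$. Here ''equivalently'' means that both problems have the same optimal value, and $a\in\mathcal{F}$ is optimal for the first problem if and only if it is the $a$-component of some optimal solution of the second.
   Context: $\mathbb{R}_+=[0,\infty)$. The bounded ReLU with cutoff $1$ is $\varphi(z)=\min(1,\max(0,z))$, applied componentwise. An MVNN (monotone-value neural network) with cutoff $1$, $K\ge1$ and layer dimensions $d^0=m,d^1,\dots,d^{K-1},d^K=1$ is the function $\mathcal{N}_{(W,b)}:\{0,1\}^m\to\mathbb{R}_+$, $\mathcal{N}_{(W,b)}(x)=W^{K}z^{K-1}$, where $z^0=x$ and $z^k=\varphi(W^kz^{k-1}+b^k)$ for $k=1,\dots,K-1$, with $W^k\in\mathbb{R}^{d^k\times d^{k-1}}$ entrywise $\ge 0$ ($k=1,\dots,K$) and $b^k\in\mathbb{R}^{d^k}$ entrywise $\le 0$ ($k=1,\dots,K-1$); the output layer has no bias and no activation. ''Large enough'' (big-M constants) means: there is a threshold, depending only on the networks, such that the assertion holds for all choices of the constants $L_1^{i,k},\dots,L_4^{i,k}$ that are at least this threshold. *)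

(* Defs.v *)
From HB Require Import structures.
From mathcomp Require Import all_boot all_order all_algebra.
From mathcomp Require Import reals.

Set Implicit Arguments.
Unset Strict Implicit.
Unset Printing Implicit Defensive.

Import Order.TTheory GRing.Theory Num.Theory.
Local Open Scope ring_scope.

Definition bReLU (R : realType) (t : R) : R := Num.min 1 (Num.max 0 t).

(* The layer dimensions d^0 = m, d^1 = hid 0, d^2 = hid 1, ...; d^0 = m holds
   by conversion. *)
Definition layer_dim (m : nat) (hid : nat -> nat) (k : nat) : nat :=
  if k is k'.+1 then hid k' else m.

(* A network with K = depth + 1 layers, so every K >= 1 is covered.  Indices
   are shifted by one: weight k and bias k are W^(k+1) and b^(k+1), of sizes
   d^(k+1) x d^k and d^(k+1); out_weight is W^K, a row because d^K = 1.  The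
   values hid k, weight k and bias k with k >= depth are never used. *)
Record mvnn (R : realType) (m : nat) := MVNN {
  depth : nat;
  hid : nat -> nat;
  weight : forall k, 'M[R]_(layer_dim m hid k.+1, layer_dim m hid k);
  bias : forall k, 'cV[R]_(layer_dim m hid k.+1);
  out_weight : 'rV[R]_(layer_dim m hid depth);
  weight_ge0 : forall k, (k < depth)%N -> forall p q, 0 <= weight k p q;
  bias_le0 : forall k, (k < depth)%N -> forall p, bias k p 0 <= 0;
  out_weight_ge0 : forall q, 0 <= out_weight 0 q
}.

Definition dim (R : realType) (m : nat) (N : mvnn R m) (k : nat) : nat :=
  layer_dim m (hid N) k.

(* {0,1}^d is 'cV[bool]_d, embedded in R^d by false |-> 0, true |-> 1. *)
Definition real_of_bool (R : realType) (d : nat) (x : 'cV[bool]_d) : 'cV[R]_d :=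
  map_mx (fun b : bool => b%:R) x.

Definition pre_activation (R : realType) (m : nat) (N : mvnn R m) (k : nat)
    (z : 'cV[R]_(dim N k)) : 'cV[R]_(dim N k.+1) :=
  weight N k *m z + bias N k.

Fixpoint activation (R : realType) (m : nat) (N : mvnn R m) (x : 'cV[bool]_m)
    (k : nat) : 'cV[R]_(dim N k) :=
  match k with
  | 0%N => real_of_bool R x
  | k'.+1 => map_mx (@bReLU R) (pre_activation (activation N x k'))
  end.

Definition output (R : realType) (m : nat) (N : mvnn R m)
    (z : 'cV[R]_(dim N (depth N))) : R :=
  (out_weight N *m z) 0 0.

Definition mvnn_fun (R : realType) (m : nat) (N : mvnn R m) (x : 'cV[bool]_m)
    : R :=
  output (activation N x (depth N)).

Definition allocation (n m : nat) := {ffun 'I_n -> 'cV[bool]_m}.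

Definition feasible (n m : nat) (a : allocation n m) : Prop :=
  forall j : 'I_m, (\sum_(i < n) (a i j 0%R : nat) <= 1)%N.

Definition welfare (R : realType) (n m : nat) (N : 'I_n -> mvnn R m)
    (a : allocation n m) : R :=
  \sum_(i < n) mvnn_fun (N i) (a i).

(* Here zvar i k is z^(i,k), whereas etavar, muvar and yvar i k are
   eta^(i,k+1), mu^(i,k+1) and y^(i,k+1).  The components zvar i k with
   k > depth (N i), and the others with k >= depth (N i), are not variables of
   the program: they occur neither in its constraints nor in its objective. *)
Record milp_point (R : realType) (n m : nat) (N : 'I_n -> mvnn R m) :=
  MilpPoint {
  alloc : allocation n m;
  zvar : forall i k, 'cV[R]_(dim (N i) k);
  etavar : forall i k, 'cV[R]_(dim (N i) k.+1);
  muvar : forall i k, 'cV[bool]_(dim (N i) k.+1);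
  yvar : forall i k, 'cV[bool]_(dim (N i) k.+1)
}.

(* The constants L1 i k, ..., L4 i k are those of layer k+1 of network i. *)
Definition milp_feasible (R : realType) (n m : nat) (N : 'I_n -> mvnn R m)
    (L1 L2 L3 L4 : 'I_n -> nat -> R) (s : milp_point N) : Prop :=
  [/\ feasible (alloc s),
      forall i, zvar s i 0%N = real_of_bool R (alloc s i)
    & forall i k, (k < depth (N i))%N -> forall p : 'I_(dim (N i) k.+1),
        let u := pre_activation (zvar s i k) p 0 in
        let z := zvar s i k.+1 p 0 in
        let eta := etavar s i k p 0 in
        let mu := real_of_bool R (muvar s i k) p 0 in
        let y := real_of_bool R (yvar s i k) p 0 in
        [/\ u <= eta,
            eta <= u + y * L1 i k,
            0 <= eta <= (1 - y) * L2 i k,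
            eta - mu * L3 i k <= z <= eta
          & 1 - (1 - mu) * L4 i k <= z <= 1]].

Definition milp_objective (R : realType) (n m : nat) (N : 'I_n -> mvnn R m)
    (s : milp_point N) : R :=
  \sum_(i < n) output (zvar s i (depth (N i))).

Definition is_optimal (R : realType) (T : Type) (S : T -> Prop) (f : T -> R)
    (x : T) : Prop :=
  S x /\ forall y, S y -> f y <= f x.

Definition is_optimal_value (R : realType) (T : Type) (S : T -> Prop)
    (f : T -> R) (v : R) : Prop :=
  exists2 x, is_optimal S f x & f x = v.

(* Main.v *)
(** For every choice of the constants, the constraints force eta = max(0, u)
    and z = min(1, eta) (u being the pre-activation): y = 1 gives eta = 0 >= u,
    y = 0 gives eta = u >= 0; mu = 1 gives z = 1 <= eta, mu = 0 gives
    z = eta <= 1.  Largeness is needed only so that the exact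
    activations are feasible, which holds once the constants dominate 1 and
    all |u| over the finitely many inputs. *)

Require Import Defs.
From HB Require Import structures.
From mathcomp Require Import all_boot all_order all_algebra.
From mathcomp Require Import reals.
From mathcomp Require Import lra.

Set Implicit Arguments.
Unset Strict Implicit.
Unset Printing Implicit Defensive.

Import Order.TTheory GRing.Theory Num.Theory.
Local Open Scope ring_scope.

Lemma bReLU_big_M (R : realType) (L1 L2 L3 L4 u z eta : R) (mu y : bool) :
  u <= eta -> eta <= u + y%:R * L1 -> 0 <= eta <= (1 - y%:R) * L2 ->
  eta - mu%:R * L3 <= z <= eta -> 1 - (1 - mu%:R) * L4 <= z <= 1 ->
  z = bReLU u.
Proof.
move=> u_le eta_le /andP[eta_ge0 eta_le2] /andP[z_ge z_le] /andP[z_ge1 z_le1].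
rewrite /bReLU; have -> : Num.max 0 u = eta.
  case: y eta_le eta_le2; rewrite ?mul1r ?mul0r ?subrr ?mul0r => ? ?;
    by case: leP => ?; apply: le_anti; lra.
case: mu z_ge z_ge1; rewrite ?mul1r ?mul0r ?subrr ?mul0r => ? ?;
  by case: leP => ?; apply: le_anti; lra.
Qed.

(** With [y] set when [u <= 0] and [mu] set when [eta] reaches 1, each constant has one inequality
    to relax: [L1] must cover [- u] when [u <= 0], [L2] must cover [u] when [u > 0], [L3] must cover
    [eta - 1], and [L4] must cover 1 because [bReLU u] can be 0. *)
Lemma big_M_bReLU (R : realType) (L1 L2 L3 L4 u : R) :
    `|u| <= L1 -> `|u| <= L2 -> `|u| <= L3 -> 1 <= L4 ->
  let eta := Num.max 0 u in
  let mu : R := (1 <= eta)%R%:R in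
  let y : R := (u <= 0)%R%:R in
  [/\ u <= eta, eta <= u + y * L1, 0 <= eta <= (1 - y) * L2,
      eta - mu * L3 <= bReLU u <= eta
    & 1 - (1 - mu) * L4 <= bReLU u <= 1].
Proof.
rewrite !ler_norml /bReLU => /andP[? ?] /andP[? ?] /andP[? ?] ? /=.
case: (leP u 0) => ?; case: (leP 1) => ? /=;
  rewrite ?mul1r ?mul0r ?subrr ?mul0r; split; do ?[apply/andP; split]; lra.
Qed.

Section BigM.
Variables (R : realType) (n m : nat) (N : 'I_n -> mvnn R m).

(** A sum in place of a maximum: it bounds each of its nonnegative terms and makes sense over empty
    index sets. The leading 1 is there for [L4]. *)
Definition big_M : R :=
  1 + \sum_(i < n) \sum_(k < depth (N i)) \sum_(x : 'cV[bool]_m)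
        \sum_p `|pre_activation (activation (N i) x k) p 0|.

Lemma big_M_ge1 : 1 <= big_M.
Proof. by rewrite lerDl; do !apply: sumr_ge0 => ? _. Qed.

Lemma pre_activation_le_big_M i k x p :
  (k < depth (N i))%N ->
  `|pre_activation (activation (N i) x k) p 0| <= big_M.
Proof.
move=> k_lt; apply: ler_wpDl => //.
(* The wanted term sits under four nested sums of nonnegative terms; each use of [le_sum] peels off
   one of them. *)
have le_sum (I : finType) (F : I -> R) j :
    (forall l, 0 <= F l) -> F j <= \sum_l F l.
  by move=> F0; rewrite (bigD1 j) //= lerDl sumr_ge0.
apply: le_trans (le_sum _ _ i _); last by move=> ?; do !apply: sumr_ge0 => ? _.
apply: le_trans (le_sum _ _ (Ordinal k_lt) _);
  last by move=> ?; do !apply: sumr_ge0 => ? _.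
apply: le_trans (le_sum _ _ x _); last by move=> ?; apply: sumr_ge0.
exact: (le_sum _ (fun p => `|pre_activation (activation (N i) x k) p 0|)).
Qed.

Variables L1 L2 L3 L4 : 'I_n -> nat -> R.

(** Induction on the layer: once layer [k] agrees with the network, the constraints producing layer
    [k.+1] involve the network's own pre-activation, and [bReLU_big_M] determines each component. *)
Lemma milp_feasible_activation (s : milp_point N) :
  milp_feasible L1 L2 L3 L4 s -> forall i k, (k <= depth (N i))%N ->
  zvar s i k = activation (N i) (alloc s i) k.
Proof.
move=> [_ z0 zS] i; elim=> [|k IHk] k_le; first by rewrite z0.
apply/colP => p; rewrite /= [RHS]mxE -IHk 1?ltnW //.
have [] := zS i k k_le p; rewrite ![real_of_bool _ _ _ _]mxE.
exact: bReLU_big_M.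
Qed.

Lemma milp_objective_welfare (s : milp_point N) :
  milp_feasible L1 L2 L3 L4 s -> milp_objective s = welfare N (alloc s).
Proof.
move=> s_feas; apply: eq_bigr => i _.
by rewrite (milp_feasible_activation s_feas).
Qed.

(** A right inverse of [alloc], with the binaries chosen as in [big_M_bReLU]. *)
Definition milp_of_alloc (a : allocation n m) : milp_point N :=
  let u i k := pre_activation (activation (N i) (a i) k) in
  @MilpPoint R n m N a (fun i => activation (N i) (a i))
    (fun i k => map_mx (Num.max 0) (u i k))
    (fun i k => map_mx (fun t => 1 <= Num.max 0 t) (u i k))
    (fun i k => map_mx (fun t => t <= 0) (u i k)).

Hypothesis L_large : forall i k, (k < depth (N i))%N ->
  [/\ big_M <= L1 i k, big_M <= L2 i k, big_M <= L3 i k & big_M <= L4 i k].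

Lemma milp_of_alloc_feasible a :
  feasible a -> milp_feasible L1 L2 L3 L4 (milp_of_alloc a).
Proof.
move=> a_feas; split=> // i k k_lt p.
have u_le := pre_activation_le_big_M (a i) p k_lt.
have [LL1 LL2 LL3 LL4] := L_large k_lt.
have := big_M_bReLU (le_trans u_le LL1) (le_trans u_le LL2)
  (le_trans u_le LL3) (le_trans big_M_ge1 LL4).
by rewrite /= !mxE.
Qed.

End BigM.

(** There are finitely many allocations, and the one giving no item to anybody is feasible. *)
Lemma welfare_optimum (R : realType) (n m : nat) (N : 'I_n -> mvnn R m) :
  exists a, is_optimal (@feasible n m) (welfare N) a.
Proof.
pose P (a : allocation n m) := [forall j, (\sum_(i < n) (a i j 0%R : nat) <= 1)%N].
have P0 : P [ffun=> const_mx false].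
  by apply/forallP => j; rewrite big1 // => i _; rewrite ffunE mxE.
case: (arg_maxP (welfare N) P0) => a /forallP a_feas a_max.
by exists a; split=> // b b_feas; apply/a_max/forallP.
Qed.

Theorem theorem2 (R : realType) (n m : nat) (N : 'I_n -> mvnn R m) :
  exists2 L0 : R, 0 <= L0 &
    forall L1 L2 L3 L4 : 'I_n -> nat -> R,
      (forall i k, (k < depth (N i))%N ->
         [/\ L0 <= L1 i k, L0 <= L2 i k, L0 <= L3 i k & L0 <= L4 i k]) ->
      (exists v : R,
         is_optimal_value (@feasible n m) (welfare N) v /\
         is_optimal_value (@milp_feasible R n m N L1 L2 L3 L4)
           (@milp_objective R n m N) v) /\
      (forall a : allocation n m,
         is_optimal (@feasible n m) (welfare N) a <->
         exists2 s : milp_point N,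
           is_optimal (@milp_feasible R n m N L1 L2 L3 L4)
             (@milp_objective R n m N) s
           & alloc s = a).
Proof.
exists (big_M N) => [|L1 L2 L3 L4 L_large]; first exact: le_trans (big_M_ge1 N).
have feas_alloc s : milp_feasible L1 L2 L3 L4 s -> feasible (alloc s) by case.
have objE := @milp_objective_welfare R n m N L1 L2 L3 L4.
have lift_feas := milp_of_alloc_feasible L_large.
have lift_opt a : is_optimal (@feasible n m) (welfare N) a ->
    is_optimal (@milp_feasible R n m N L1 L2 L3 L4)
      (@milp_objective R n m N) (milp_of_alloc N a).
  move=> [a_feas a_max]; split=> [|s s_feas]; first exact: lift_feas.
  (* The objective at the lift of [a] is [welfare N a] by conversion, so it remains to compare [a]
     with [alloc s]. *)
  by rewrite (objE s) // a_max //; apply: feas_alloc.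
split=> [|a].
  have [a a_opt] := welfare_optimum N.
  exists (welfare N a); split; first by exists a.
  by exists (milp_of_alloc N a); first exact: lift_opt.
split=> [a_opt|[s [s_feas s_max] <-]].
  by exists (milp_of_alloc N a); first exact: lift_opt.
split=> [|b b_feas]; first exact: feas_alloc.
(* A competitor [b] is compared with [alloc s] through its lift, which [s] dominates in the
   program. *)
have b_lift := lift_feas b b_feas.
by rewrite -(objE s) // -(objE _ b_lift) s_max.
Qed.
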